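(* Let $n$ be a positive integer, let $Y$ be a compact Hausdorff space, and let $Y_1\subseteq Y$ be a closed subset. Let $\sim$ be the equivalence relation on $X_n\times Y$ and $\alpha: C(X_n\times Y)\to C(X_n\times Y)\otimes A_n$ the action of the quantum permutation group $A_n$ on $X_n\times Y$ defined in the context. Then the restriction of $\alpha$ to the C*-subalgebra $C((X_n\times Y)/\sim)$ of $C(X_n\times Y)$ induces an action $\widetilde{\alpha}$ of $A_n$ on $(X_n\times Y)/\sim$; that is, $\alpha(C((X_n\times Y)/\sim))\subseteq C((X_n\times Y)/\sim)\otimes A_n$, and the resulting map $\widetilde{\alpha}: C((X_n\times Y)/\sim)\to C((X_n\times Y)/\sim)\otimes A_n$ is an action of $(A_n,\Delta_n)$.
   Context: Tensor products of unital C*-algebras are minimal. For a $*$-homomorphism $\beta:B\to B\otimes A$, $\beta(B)(1\otimes A)$ denotes the linear span of $\{\beta(b)(1_B\otimes a): b\in B, a\in A\}$ and $\beta(B)(B\otimes 1)$ the linear span of $\{\beta(b_1)(b_2\otimes 1_A): b_1,b_2\in B\}$. A compact quantum group is a unital C*-algebra $A$ with a unital $*$-homomorphism $\Delta:A\to A\otimes A$ such that $(\Delta\otimes id)\Delta=(id\otimes\Delta)\Delta$ and both $\Delta(A)(1\otimes A)$ and $\Delta(A)(A\otimes 1)$ are dense in $A\otimes A$. An action of $(A,\Delta)$ on a unital C*-algebra $B$ is a unital $*$-homomorphism $\alpha:B\to B\otimes A$ with $(\alpha\otimes id)\alpha=(id\otimes\Delta)\alpha$ and $\alpha(B)(1\otimes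 A)$ dense in $B\otimes A$. An action on a compact Hausdorff space $X$ means an action on $C(X)$, the C*-algebra of continuous complex-valued functions on $X$. Quantum permutation group: $A_n$ is the universal C*-algebra generated by $a_{ij}$ ($1\le i,j\le n$) with relations $a_{ij}^*=a_{ij}=a_{ij}^2$ and $\sum_{i=1}^n a_{ij}=\sum_{j=1}^n a_{ij}=1$, with comultiplication $\Delta_n(a_{ij})=\sum_{k=1}^n a_{ik}\otimes a_{kj}$; $(A_n,\Delta_n)$ is a compact quantum group. $X_n=\{x_1,\dots,x_n\}$ is the discrete space with $n$ points, and $e_i\in C(X_n)$ is given by $e_i(x_j)=\delta_{ij}$. Identify $C(X_n\times Y)=C(X_n)\otimes C(Y)$. The action $\alpha$ of $A_n$ on $X_n\times Y$ is the one given by $\alpha(e_i\otimes f)=\sum_{k=1}^n e_k\otimes f\otimes a_{ki}$ for $1\le i\le n$, $f\in C(Y)$. Equivalence relation: $(x',y')\sim(x'',y'')$ iff either $y'=y''\in Y_1$, or $y'=y''$ and $x'=x''$. The quotient $(X_n\times Y)/\sim$ is compact Hausdorff, and $C((X_n\times Y)/\sim)$ is regarded as the C*-subalgebra of $C(X_n\times Y)$ of functions constant on equivalence classes. *)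

(* Defs.v *)
From HB Require Import structures.
From mathcomp Require Import all_boot all_order all_algebra generic_quotient.
From mathcomp Require Import complex.
From mathcomp Require Import all_classical all_reals.
From mathcomp Require Import topology normedtype.

Set Implicit Arguments.
Unset Strict Implicit.
Unset Printing Implicit Defensive.

Import Order.TTheory GRing.Theory Num.Theory.
Import numFieldNormedType.Exports.

Local Open Scope classical_set_scope.
Local Open Scope ring_scope.

(* Unital C*-algebras: complex Banach spaces (the norm takes values in the
   nonnegative reals of R[i]) with a product, a unit and an involution.  The
   product is part of the mixin because the hierarchy of numeric rings does not
   allow a new join of rings and normed spaces.  The zero algebra, which is
   C(X) for X empty, is allowed, hence pzRingType below. *)
HB.mixin Record isCStarAlgebra (R : realType) A
    & CompleteNormedModule R[i] A := {
  cmul : A -> A -> A;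
  cone : A;
  star : A -> A;
  cmulA : associative cmul;
  cmul1x : left_id cone cmul;
  cmulx1 : right_id cone cmul;
  cmulDl : left_distributive cmul +%R;
  cmulDr : right_distributive cmul +%R;
  cscaleAl : forall (c : R[i]) (x y : A), c *: cmul x y = cmul (c *: x) y;
  cscaleAr : forall (c : R[i]) (x y : A), c *: cmul x y = cmul x (c *: y);
  starD : forall x y : A, star (x + y) = star x + star y;
  starZ : forall (c : R[i]) (x : A), star (c *: x) = c^* *: star x;
  starM : forall x y : A, star (cmul x y) = cmul (star y) (star x);
  starK : forall x : A, star (star x) = x;
  cnormM_le : forall x y : A, `|cmul x y| <= `|x| * `|y|;
  cstar_identity : forall x : A, `|cmul (star x) x| = `|x| ^+ 2
}.

#[short(type="cstarType")]
HB.structure Definition CStarAlgebra (R : realType) :=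
  {A of isCStarAlgebra R A & CompleteNormedModule R[i] A}.

Lemma cmul0x (R : realType) (A : cstarType R) : left_zero (0 : A) cmul.
Proof. by move=> x; apply: (addrI (cmul 0 x)); rewrite -cmulDl !addr0. Qed.
Lemma cmulx0 (R : realType) (A : cstarType R) : right_zero (0 : A) cmul.
Proof. by move=> x; apply: (addrI (cmul x 0)); rewrite -cmulDr !addr0. Qed.

(* gives access to the notations 1 and *, and to the theory of rings *)
#[non_forgetful_inheritance]
HB.instance Definition _ (R : realType) (A : cstarType R) :=
  GRing.Zmodule_isPzRing.Build (CStarAlgebra.sort A)
    cmulA cmul1x cmulx1 cmulDl cmulDr.

(* Hilbert spaces are the Banach spaces whose norm comes from an inner product,
   here linear in its first argument. *)
HB.mixin Record isHilbert (R : realType) H & CompleteNormedModule R[i] H := {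
  dot : H -> H -> R[i];
  dotDl : forall x y z : H, dot (x + y) z = dot x z + dot y z;
  dotZl : forall (c : R[i]) (x y : H), dot (c *: x) y = c * dot x y;
  dotC : forall x y : H, dot y x = (dot x y)^*;
  dot_norm : forall x : H, dot x x = `|x| ^+ 2
}.

#[short(type="hilbertType")]
HB.structure Definition Hilbert (R : realType) :=
  {H of isHilbert R H & CompleteNormedModule R[i] H}.

Record compHaus := CompHaus {
  ch_space :> topologicalType;
  ch_compact : compact [set: ch_space];
  ch_hausdorff : hausdorff_space ch_space
}.

Section complex_complete.
Variable R : realType.
Implicit Types (z w : R[i]) (e : R).

Definition cabs z : R := complex.Re `|z|.

Lemma cabsE z : `|z| = (cabs z)%:C%C.
Proof. by rewrite /cabs RRe_real//; exact: normr_real. Qed.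

Lemma cabs_ge0 z : 0 <= cabs z.
Proof. by rewrite -lecR -cabsE; exact: normr_ge0. Qed.

Lemma cabsD z w : cabs (z + w) <= cabs z + cabs w.
Proof. by rewrite -lecR rmorphD/= -!cabsE; exact: ler_normD. Qed.

Lemma cabsM z w : cabs (z * w) = cabs z * cabs w.
Proof. by apply: (@complexI R); rewrite rmorphM/= -!cabsE; exact: normrM. Qed.

Lemma cabsN z : cabs (- z) = cabs z.
Proof. by apply: (@complexI R); rewrite -!cabsE; exact: normrN. Qed.

Lemma cabs_dist z w : `|cabs z - cabs w| <= cabs (z - w).
Proof.
rewrite ler_norml; apply/andP; split.
  by rewrite lerNl opprB lerBlDr -[cabs (z - w)]cabsN opprB -[X in cabs X <= _](subrK z) cabsD.
by rewrite lerBlDr -[X in cabs X <= _](subrK w) cabsD.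
Qed.

Lemma cabs0 : cabs 0 = 0.
Proof. by apply: (@complexI R); rewrite -cabsE; exact: normr0. Qed.

Lemma cabs_eq0 z : cabs z = 0 -> z = 0.
Proof. by move=> z0; apply/normr0_eq0; rewrite cabsE z0. Qed.

Lemma Re_cabs z : `|complex.Re z| <= cabs z.
Proof. by rewrite -lecR -cabsE normc_ge_Re. Qed.

Lemma cabs_ReIm z : cabs z <= `|complex.Re z| + `|complex.Im z|.
Proof.
case: z => a b /=; rewrite -lecR -cabsE.
rewrite [X in `|X|](_ : _ = a%:C%C + 'i%C * b%:C%C); last by simpc.
rewrite (le_trans (ler_normD _ _))// rmorphD/= lerD//.
  by rewrite normc_def/= expr0n/= addr0 sqrtr_sqr.
by rewrite normrM !normc_def/= expr0n/= expr1n addr0 add0r sqrtr1 mul1r sqrtr_sqr.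
Qed.

Lemma Im_cabs z : `|complex.Im z| <= cabs z.
Proof.
rewrite -lecR -cabsE normc_def lecR -sqrtr_sqr ler_wsqrtr//.
by rewrite lerDr sqr_ge0.
Qed.

Lemma gt0_complex (e : R[i]) : 0 < e -> {e' : R | 0 < e' & e = e'%:C%C}.
Proof.
move=> e0; exists (complex.Re e); last by rewrite RRe_real// gtr0_real.
by rewrite -ltcR RRe_real// gtr0_real.
Qed.

Lemma complex_complete (F : set_system R[i]^o) :
  ProperFilter F -> cauchy F -> cvg F.
Proof.
move=> FF /cauchyP cF.
have part (p : R[i] -> R) : (forall z, `|p z| <= cabs z) ->
    (forall z w, p (z - w) = p z - p w) ->
    cvg ((fun z : R[i]^o => p z) @ F).
  move=> ple pB; apply: cauchy_cvg; apply/cauchyP => e e0.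
  have [|z Fz] := cF e%:C%C; first by rewrite ltcR.
  exists (p z).
  suff : F [set w : R[i]^o | ball (p z) e (p w)] by [].
  apply: filterS Fz => w zw; change (`|p z - p w| < e).
  rewrite -ball_normE/= in zw.
  by rewrite -pB (le_lt_trans (ple _))// -ltcR -cabsE.
have cR := part (@complex.Re R) Re_cabs (fun z w => raddfB _ z w).
have cI := part (@complex.Im R) Im_cabs (fun z w => raddfB _ z w).
set l1 := lim _ in cR; set l2 := lim _ in cI.
apply/cvg_ex; exists (l1 +i* l2)%C; apply/cvgrPdist_lt => e0 /gt0_complex[e e_gt0 ->].
have e2 : 0 < e / 2 by rewrite divr_gt0.
have /cvgrPdist_lt/(_ _ e2) h1 := cR.
have /cvgrPdist_lt/(_ _ e2) h2 := cI.
near=> z; rewrite cabsE ltcR (le_lt_trans (cabs_ReIm _))// (splitr e) ltrD//.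
- by rewrite raddfB/=; near: z.
- by rewrite raddfB/=; near: z.
Unshelve. all: by end_near. Qed.

End complex_complete.
(* The C*-algebra of continuous complex functions on X, with pointwise
   operations and the supremum norm; R[i]^o is R[i] with its topology. *)
Section continuous_functions.
Variables (R : realType) (X : compHaus).

Definition contAlg : Type := continuousType X R[i]^o.

HB.instance Definition _ := Choice.on contAlg.

Implicit Types f g h : contAlg.

Definition contFun f : X -> R[i] := f.

Lemma contP f g : (forall x, contFun f x = contFun g x) -> f = g.
Proof. by move=> fg; apply/continuousEP. Qed.

Definition mkcont (f : X -> R[i]^o) (cf : continuous f) : contAlg := mkcts cf.

Lemma contFun_continuous f : continuous (contFun f : X -> R[i]^o).
Proof. exact: cts_fun. Qed.

Lemma cadd_subproof f g :
  continuous (fun x => contFun f x + contFun g x : R[i]^o).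
Proof. by move=> x; apply: cvgD; exact: contFun_continuous. Qed.

Lemma cmul_subproof f g :
  continuous (fun x => contFun f x * contFun g x : R[i]^o).
Proof. by move=> x; apply: (@cvgM R[i]); exact: contFun_continuous. Qed.

Lemma copp_subproof f : continuous (fun x => - contFun f x : R[i]^o).
Proof. by move=> x; apply: cvgN; exact: contFun_continuous. Qed.

Lemma ccst_subproof (c : R[i]) : continuous (fun _ : X => c : R[i]^o).
Proof. by move=> x; exact: cvg_cst. Qed.

Lemma cconj_subproof f : continuous (fun x => (contFun f x)^* : R[i]^o).
Proof.
move=> x; apply/cvgrPdist_lt => e e0.
have /cvgrPdist_lt/(_ _ e0) := @contFun_continuous f x.
by apply: filterS => y; rewrite -rmorphB/= norm_conjC.
Qed.

Definition cadd f g := mkcont (@cadd_subproof f g).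
Definition copp f := mkcont (@copp_subproof f).
Definition cmulf f g := mkcont (@cmul_subproof f g).
Definition ccst c := mkcont (@ccst_subproof c).
Definition cconj f := mkcont (@cconj_subproof f).
Definition cscale (c : R[i]) f := cmulf (ccst c) f.

Fact caddA : associative cadd.
Proof. by move=> f g h; apply: contP => x; exact: addrA. Qed.
Fact caddC : commutative cadd.
Proof. by move=> f g; apply: contP => x; exact: addrC. Qed.
Fact cadd0 : left_id (ccst 0) cadd.
Proof. by move=> f; apply: contP => x; exact: add0r. Qed.
Fact caddN : left_inverse (ccst 0) copp cadd.
Proof. by move=> f; apply: contP => x; exact: addNr. Qed.

HB.instance Definition _ :=
  GRing.isZmodule.Build contAlg caddA caddC cadd0 caddN.

Fact cscaleA (a b : R[i]) f : cscale a (cscale b f) = cscale (a * b) f.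
Proof. by apply: contP => x; exact: mulrA. Qed.
Fact cscale1 : left_id 1 cscale.
Proof. by move=> f; apply: contP => x; exact: mul1r. Qed.
Fact cscaleDr : right_distributive cscale +%R.
Proof. by move=> a f g; apply: contP => x; exact: mulrDr. Qed.
Fact cscaleDl f : {morph cscale^~ f : a b / a + b}.
Proof. by move=> a b; apply: contP => x; exact: mulrDl. Qed.

HB.instance Definition _ := GRing.Zmodule_isLmodule.Build R[i] contAlg
  cscaleA cscale1 cscaleDr cscaleDl.

Definition supnorm f : R := sup (range (fun x => cabs (contFun f x))).

Lemma supnorm_has_ub f : has_ubound (range (fun x => cabs (contFun f x))).
Proof.
have cf : continuous (fun x => cabs (contFun f x) : R).
  move=> x; apply/cvgrPdist_lt => e e0.
  have e0' : (0 : R[i]) < e%:C%C by rewrite ltcR.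
  have /cvgrPdist_lt/(_ _ e0') := @contFun_continuous f x.
  apply: filterS => y; rewrite cabsE ltcR; apply: le_lt_trans.
  exact: cabs_dist.
have [M [_ HM]] := compact_bounded
  (continuous_compact (continuous_subspaceT cf) (@ch_compact X)).
exists (M + 1) => _ [x _ <-].
have /HM : M < M + 1 by rewrite ltrDl.
move=> /(_ (cabs (contFun f x))) h; apply: le_trans (h _); last by exists x.
exact: ler_norm.
Qed.

Lemma supnorm_ub f x : cabs (contFun f x) <= supnorm f.
Proof. by apply: ub_le_sup; [exact: supnorm_has_ub|exists x]. Qed.

Lemma supnorm_le f M : 0 <= M -> (forall x, cabs (contFun f x) <= M) ->
  supnorm f <= M.
Proof.
move=> M0 fM; rewrite /supnorm.
have [->|/set0P ne] := eqVneq (range (fun x => cabs (contFun f x))) set0.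
  by rewrite sup0.
by apply: ge_sup => // _ [x _ <-].
Qed.

Lemma supnorm_ge0 f : 0 <= supnorm f.
Proof.
rewrite /supnorm.
have [->|/set0P [_ [x _ _]]] := eqVneq (range (fun x => cabs (contFun f x))) set0.
  by rewrite sup0.
exact: le_trans (cabs_ge0 _) (supnorm_ub f x).
Qed.

Definition cnorm f : R[i] := (supnorm f)%:C%C.

Fact cnormD f g : cnorm (f + g) <= cnorm f + cnorm g.
Proof.
rewrite -rmorphD lecR; apply: supnorm_le; first by apply: addr_ge0; exact: supnorm_ge0.
by move=> x; rewrite (le_trans (cabsD _ _))// lerD ?supnorm_ub.
Qed.

Fact cnormZ (c : R[i]) f : cnorm (c *: f) = `|c| * cnorm f.
Proof.
rewrite cabsE -rmorphM; congr (_%:C%C); apply/le_anti/andP; split.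
  apply: supnorm_le; first by apply: mulr_ge0; [exact: cabs_ge0|exact: supnorm_ge0].
  move=> x; rewrite [X in X <= _](_ : _ = cabs c * cabs (contFun f x)).
    by rewrite ler_wpM2l ?cabs_ge0 ?supnorm_ub.
  exact: cabsM.
have [->|c0] := eqVneq c 0; first by rewrite cabs0 mul0r supnorm_ge0.
have c_gt0 : 0 < cabs c.
  rewrite lt_neqAle cabs_ge0 andbT eq_sym; apply: contra c0 => /eqP c0.
  by apply/eqP/cabs_eq0.
rewrite mulrC -ler_pdivlMr//; apply: supnorm_le.
  by apply: divr_ge0; [exact: supnorm_ge0|exact: cabs_ge0].
move=> x; rewrite ler_pdivlMr// mulrC -cabsM.
exact: (supnorm_ub (c *: f) x).
Qed.

Fact cnorm0_eq0 f : cnorm f = 0 -> f = 0.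
Proof.
move=> f0; apply: contP => x; apply: cabs_eq0; apply/le_anti.
rewrite cabs_ge0 andbT.
by rewrite (_ : 0 = supnorm f) ?supnorm_ub//; exact/esym/(@complexI R).
Qed.

HB.instance Definition _ := Lmodule_isNormed.Build R[i] contAlg
  cnormD cnormZ cnorm0_eq0.

Lemma contAlg_complete (F : set_system contAlg) :
  ProperFilter F -> cauchy F -> cvg F.
Proof.
move=> FF /cauchyP cF.
have normE f : `|f| = (supnorm f)%:C%C by [].
have cx (x : X) : cvg ((fun f : contAlg => contFun f x : R[i]^o) @ F).
  apply: complex_complete; apply/cauchyP => e e0.
  have [f Ff] := cF e e0; exists (contFun f x).
  suff : F [set g : contAlg | ball (contFun f x : R[i]^o) e (contFun g x)] by [].
  apply: filterS Ff => g; rewrite -!ball_normE/= normE; apply: le_lt_trans.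
  by rewrite cabsE lecR; exact: (supnorm_ub (f - g) x).
pose l x : R[i]^o := lim ((fun f : contAlg => contFun f x : R[i]^o) @ F).
have ul (e : R) : 0 < e ->
    \forall f \near F, forall x, cabs (l x - contFun f x) <= e.
  move=> e0.
  have e2 : 0 < e / 2 by rewrite divr_gt0.
  have e4 : 0 < e / 2 / 2 by rewrite divr_gt0.
  have [|f Ff] := cF (e / 2 / 2)%:C%C; first by rewrite ltcR.
  have H g : ball f (e / 2 / 2)%:C%C g ->
      forall x, cabs (contFun f x - contFun g x) <= e / 2 / 2.
    rewrite -ball_normE/= normE ltcR => fg x; apply: le_trans (ltW fg).
    exact: (supnorm_ub (f - g) x).
  apply: filterS (Ff) => g /H fg x.
  have e2' : (0 : R[i]) < (e / 2)%:C%C by rewrite ltcR.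
  have /cvgrPdist_lt/(_ _ e2') lx := cx x.
  have [h [/H fh]] := @filter_ex _ F FF _ (filterI Ff lx).
  rewrite /= cabsE ltcR => lh.
  rewrite -(subrKA (contFun h x)) (le_trans (cabsD _ _))// (splitr e).
  rewrite lerD//; first exact: ltW.
  rewrite -(subrKA (contFun f x)) (le_trans (cabsD _ _))// (splitr (e / 2)).
  by rewrite lerD// -cabsN opprB.
have cl : continuous l.
  move=> x; apply/cvgrPdist_lt => e0 /gt0_complex[e e_gt0 ->].
  have e2 : 0 < e / 2 by rewrite divr_gt0.
  have e4 : 0 < e / 2 / 2 by rewrite divr_gt0.
  have [f lf] := @filter_ex _ F FF _ (ul _ e4).
  have e2' : (0 : R[i]) < (e / 2)%:C%C by rewrite ltcR.
  have /cvgrPdist_lt/(_ _ e2') := @contFun_continuous f x.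
  apply: filterS => y; rewrite !cabsE !ltcR => fxy.
  rewrite -(subrKA (contFun f x)) (le_lt_trans (cabsD _ _))//.
  rewrite (splitr e) {1}(splitr (e / 2)) -addrA ler_ltD//.
  rewrite -(subrKA (contFun f y)) (le_lt_trans (cabsD _ _))//.
  rewrite [X in _ < X]addrC; apply: ltr_leD => //.
  by rewrite -cabsN opprB.
apply/cvg_ex; exists (mkcont cl); apply/cvgrPdist_lt => e0 /gt0_complex[e e_gt0 ->].
have e2 : 0 < e / 2 by rewrite divr_gt0.
apply: filterS (ul _ e2) => f lf; rewrite normE ltcR.
rewrite (@le_lt_trans _ _ (e / 2))//; last first.
  by rewrite ltr_pdivrMr// ltr_pMr// ltrDl.
by apply: supnorm_le; [exact: ltW|exact: lf].
Qed.

HB.instance Definition _ := Uniform_isComplete.Build contAlg contAlg_complete.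

Fact cmulfA : associative cmulf.
Proof. by move=> f g h; apply: contP => x; exact: mulrA. Qed.
Fact cmulf1l : left_id (ccst 1) cmulf.
Proof. by move=> f; apply: contP => x; exact: mul1r. Qed.
Fact cmulf1r : right_id (ccst 1) cmulf.
Proof. by move=> f; apply: contP => x; exact: mulr1. Qed.
Fact cmulfDl : left_distributive cmulf +%R.
Proof. by move=> f g h; apply: contP => x; exact: mulrDl. Qed.
Fact cmulfDr : right_distributive cmulf +%R.
Proof. by move=> f g h; apply: contP => x; exact: mulrDr. Qed.
Fact cscale_mull (c : R[i]) f g : c *: cmulf f g = cmulf (c *: f) g.
Proof. by apply: contP => x; exact: mulrA. Qed.
Fact cscale_mulr (c : R[i]) f g : c *: cmulf f g = cmulf f (c *: g).
Proof. by apply: contP => x; exact: mulrCA. Qed.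
Fact cconjD f g : cconj (f + g) = cconj f + cconj g.
Proof. by apply: contP => x; exact: rmorphD. Qed.
Fact cconjZ (c : R[i]) f : cconj (c *: f) = c^* *: cconj f.
Proof. by apply: contP => x; exact: rmorphM. Qed.
Fact cconjM f g : cconj (cmulf f g) = cmulf (cconj g) (cconj f).
Proof. by apply: contP => x; rewrite [RHS]mulrC; exact: rmorphM. Qed.
Fact cconjK f : cconj (cconj f) = f.
Proof. by apply: contP => x; exact: conjCK. Qed.
Fact cnormM f g : `|cmulf f g| <= `|f| * `|g|.
Proof.
change (cnorm (cmulf f g) <= cnorm f * cnorm g).
rewrite -rmorphM lecR; apply: supnorm_le.
  by apply: mulr_ge0; exact: supnorm_ge0.
move=> x; rewrite [X in X <= _]cabsM.
by apply: ler_pM; rewrite ?cabs_ge0 ?supnorm_ub.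
Qed.
Fact cnorm_cstar f : `|cmulf (cconj f) f| = `|f| ^+ 2.
Proof.
change (cnorm (cmulf (cconj f) f) = cnorm f ^+ 2).
have E x : cabs (contFun (cmulf (cconj f) f) x) = cabs (contFun f x) ^+ 2.
  rewrite [LHS]cabsM expr2; congr (_ * _).
  by apply: (@complexI R); rewrite -!cabsE; exact: norm_conjC.
rewrite -rmorphXn; congr (_%:C%C); apply/le_anti/andP; split.
  apply: supnorm_le; first by rewrite exprn_ge0 ?supnorm_ge0.
  by move=> x; rewrite E lerXn2r ?nnegrE ?cabs_ge0 ?supnorm_ge0 ?supnorm_ub.
have s0 := supnorm_ge0 (cmulf (cconj f) f).
rewrite -(sqr_sqrtr s0) lerXn2r ?nnegrE ?sqrtr_ge0 ?supnorm_ge0//.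
apply: supnorm_le; first exact: sqrtr_ge0.
move=> x; rewrite -(ger0_norm (cabs_ge0 _)) -sqrtr_sqr ler_wsqrtr// -E.
exact: supnorm_ub.
Qed.

HB.instance Definition _ := isCStarAlgebra.Build R contAlg
  cmulfA cmulf1l cmulf1r cmulfDl cmulfDr cscale_mull cscale_mulr
  cconjD cconjZ cconjM cconjK cnormM cnorm_cstar.

End continuous_functions.
(* C(X) as a bundled C*-algebra *)
Definition Cont (R : realType) (X : compHaus) : cstarType R := contAlg R X.

Record starHom (R : realType) (A B : cstarType R) := StarHom {
  hom_fun :> {linear A -> B};
  hom1 : hom_fun 1 = 1;
  homM : {morph hom_fun : x y / x * y};
  homS : {morph hom_fun : x / star x}
}.

(* the (non closed) linear span of S *)
Definition lspan (K : pzRingType) (V : lmodType K) (S : set V) : set V :=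
  [set x | exists2 s : seq (K * V),
     (forall p, p \in s -> S p.2) & x = \sum_(p <- s) p.1 *: p.2].

(* unital *-representations of A by bounded operators on H *)
Record starRep (R : realType) (A : cstarType R) (H : hilbertType R) := StarRep {
  rep :> A -> H -> H;
  rep_linear : forall a, linear (rep a);
  rep_bounded : forall a, exists M : R[i], forall x, `|rep a x| <= M * `|x|;
  rep_linearl : forall x, linear (rep^~ x);
  rep1 : forall x, rep 1 x = x;
  repM : forall a b x, rep (a * b) x = rep a (rep b x);
  repS : forall a x y, dot (rep a x) y = dot x (rep (star a) y)
}.

(* Vectors of the algebraic tensor product of H and K are given by finite
   families of pairs (u, v), standing for the sum of the u ⊗ v; tnorm2 is the
   squared norm of this sum for the inner product
   <u ⊗ v, u' ⊗ v'> = <u, u'><v, v'>. *)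
Definition tnorm2 (R : realType) (H K : hilbertType R) (t : seq (H * K)) : R[i] :=
  \sum_(u <- t) \sum_(v <- t) dot u.1 v.1 * dot u.2 v.2.

(* the image of t under the operator (pi ⊗ rho)(x), for x the sum of the
   a ⊗ b with (a, b) in s *)
Definition tapply (R : realType) (A B : cstarType R) (H K : hilbertType R)
    (pi : starRep A H) (rho : starRep B K) (s : seq (A * B)) (t : seq (H * K)) :
    seq (H * K) :=
  [seq (pi p.1 u.1, rho p.2 u.2) | p <- s, u <- t].

(* The operator (pi ⊗ rho)(x) has norm at most r on the Hilbert tensor product,
   for all representations pi and rho: the spatial norm of x, which is the
   supremum of the norms of these operators, is at most r.  As simple tensors
   span a dense subspace, it is enough to test algebraic tensors t. *)
Definition spatial_le (R : realType) (A B : cstarType R) (s : seq (A * B))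
    (r : R[i]) : Prop :=
  forall (H K : hilbertType R) (pi : starRep A H) (rho : starRep B K)
         (t : seq (H * K)),
    tnorm2 (tapply pi rho s t) <= r ^+ 2 * tnorm2 t.

(* The realizations of the minimal tensor product of A and B: completions of
   the algebraic tensor product, with its *-algebra structure, for the spatial
   norm.  Two of them are related by a unique *-isomorphism which preserves
   elementary tensors. *)
Record minTensor (R : realType) (A B : cstarType R) := MinTensor {
  mt_alg :> cstarType R;
  mt_elem : A -> B -> mt_alg;
  mt_linearl : forall b, linear (mt_elem^~ b);
  mt_linearr : forall a, linear (mt_elem a);
  mt1 : mt_elem 1 1 = 1;
  mtM : forall a a' b b',
    mt_elem (a * a') (b * b') = mt_elem a b * mt_elem a' b';
  mtS : forall a b, mt_elem (star a) (star b) = star (mt_elem a b);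
  mt_dense : dense (lspan [set mt_elem a b | a in [set: A] & b in [set: B]]);
  mt_norm : forall (s : seq (A * B)) (r : R[i]), 0 <= r ->
    `|\sum_(p <- s) mt_elem p.1 p.2| <= r <-> spatial_le s r
}.

(* tens is a choice of a realization of each minimal tensor product *)
Section quantum_groups.
Variables (R : realType) (tens : forall A B : cstarType R, minTensor A B).

Local Notation "A ⊗ B" := (tens A B) (at level 35, right associativity).
Local Notation "a ⊠ b" := (mt_elem (tens _ _) a b)
  (at level 35, right associativity).

(* F is f ⊗ g; it is the only *-homomorphism with this property, since
   elementary tensors span a dense subspace *)
Definition is_tensor_hom (A A' B B' : cstarType R) (f : A -> A') (g : B -> B')
    (F : starHom (A ⊗ B) (A' ⊗ B')) : Prop :=
  forall a b, F (a ⊠ b) = f a ⊠ g b.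

(* x and y are equal under the canonical identification of (A ⊗ B) ⊗ C with
   A ⊗ (B ⊗ C).  That identification is the isometric extension of the
   rebracketing of algebraic tensors, so its graph is the closure of the graph
   of the rebracketing. *)
Definition assoc_rel (A B C : cstarType R)
    (x : (A ⊗ B) ⊗ C) (y : A ⊗ (B ⊗ C)) : Prop :=
  closure [set z : ((A ⊗ B) ⊗ C) * (A ⊗ (B ⊗ C)) |
    exists s : seq (A * B * C),
      z = (\sum_(p <- s) (p.1.1 ⊠ p.1.2) ⊠ p.2,
           \sum_(p <- s) p.1.1 ⊠ (p.1.2 ⊠ p.2))] (x, y).

(* (alpha ⊗ id) alpha = (id ⊗ Delta) alpha *)
Definition coaction_identity (A B : cstarType R) (Delta : starHom A (A ⊗ A))
    (alpha : starHom B (B ⊗ A)) : Prop :=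
  exists (alpha_id : starHom (B ⊗ A) ((B ⊗ A) ⊗ A))
         (id_Delta : starHom (B ⊗ A) (B ⊗ (A ⊗ A))),
    [/\ is_tensor_hom alpha idfun alpha_id,
        is_tensor_hom idfun Delta id_Delta
      & forall b, assoc_rel (alpha_id (alpha b)) (id_Delta (alpha b))].

(* alpha(B)(1 ⊗ A) is dense in B ⊗ A *)
Definition dense_right (A B : cstarType R) (alpha : starHom B (B ⊗ A)) : Prop :=
  dense (lspan [set alpha b * (1 ⊠ a) | b in [set: B] & a in [set: A]]).

(* compact quantum groups *)
Record cqg := CQG {
  cqg_alg :> cstarType R;
  comul : starHom cqg_alg (cqg_alg ⊗ cqg_alg);
  comul_coassoc : coaction_identity comul comul;
  comul_dense_right : dense_right comul;
  comul_dense_left :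
    dense (lspan [set comul a * (b ⊠ 1)
                   | a in [set: cqg_alg] & b in [set: cqg_alg]])
}.

Definition is_action (G : cqg) (B : cstarType R)
    (alpha : starHom B (B ⊗ G)) : Prop :=
  coaction_identity (comul G) alpha /\ dense_right alpha.

Definition magic_relations (n : nat) (A : cstarType R)
    (a : 'I_n -> 'I_n -> A) : Prop :=
  [/\ forall i j, star (a i j) = a i j,
      forall i j, a i j * a i j = a i j,
      forall j, \sum_i a i j = 1
    & forall i, \sum_j a i j = 1].

(* A is the universal C*-algebra generated by the a i j subject to the
   relations above; that the a i j generate A is the uniqueness of phi. *)
Definition is_universal_magic (n : nat) (A : cstarType R)
    (a : 'I_n -> 'I_n -> A) : Prop :=
  magic_relations a /\
  forall (B : cstarType R) (b : 'I_n -> 'I_n -> B), magic_relations b ->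
    exists2 phi : starHom A B, (forall i j, phi (a i j) = b i j)
      & forall psi : starHom A B, (forall i j, psi (a i j) = b i j) -> psi =1 phi.

Definition is_quantum_permutation_group (n : nat) (G : cqg)
    (a : 'I_n -> 'I_n -> G) : Prop :=
  is_universal_magic a /\
  forall i j, comul G (a i j) = \sum_k (a i k ⊠ a k j).

End quantum_groups.

Section product.
Variables (X Y : compHaus).

Lemma prodCH_compact : compact [set: X * Y].
Proof. by rewrite -setXTT; apply: compact_setX; exact: ch_compact. Qed.

Lemma prodCH_hausdorff : hausdorff_space (X * Y)%type.
Proof.
move=> [p1 p2] [q1 q2] pq; congr pair; apply: ch_hausdorff => A B nA nB.
- have [||[x y] [/= Ax Bx]] := pq (fst @^-1` A) (fst @^-1` B).
  + exact: (@cvg_fst _ _ (nbhs p1) (nbhs p2)).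
  + exact: (@cvg_fst _ _ (nbhs q1) (nbhs q2)).
  + by exists x.
- have [||[x y] [/= Ay By]] := pq (snd @^-1` A) (snd @^-1` B).
  + exact: (@cvg_snd _ _ (nbhs p1) (nbhs p2)).
  + exact: (@cvg_snd _ _ (nbhs q1) (nbhs q2)).
  + by exists y.
Qed.

Definition prodCH : compHaus := CompHaus prodCH_compact prodCH_hausdorff.

Variable R : realType.

Lemma pure_subproof (g : contAlg R X) (f : contAlg R Y) :
  continuous (fun p : prodCH => contFun g p.1 * contFun f p.2 : R[i]^o).
Proof.
move=> [x y]; apply: (@cvgM R[i]).
  apply: (@continuous_comp _ _ _ fst (contFun g : X -> R[i]^o)).
    exact: cvg_fst.
  exact: contFun_continuous.
apply: (@continuous_comp _ _ _ snd (contFun f : Y -> R[i]^o)).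
  exact: cvg_snd.
exact: contFun_continuous.
Qed.

(* g ⊗ f, in C(X) ⊗ C(Y) identified with C(X * Y) *)
Definition pure (g : Cont R X) (f : Cont R Y) : Cont R prodCH :=
  mkcont (@pure_subproof g f).
End product.

Section finite_discrete.
Variable n : nat.

Lemma discreteCH_compact : compact [set: discrete_topology 'I_n].
Proof. exact/finite_compact/finite_finset. Qed.

Definition discreteCH : compHaus :=
  CompHaus discreteCH_compact (@discrete_hausdorff (discrete_topology 'I_n)).

Variable R : realType.

Lemma ebasis_subproof (i : 'I_n) :
  continuous (fun j : discreteCH => ((j : 'I_n) == i)%:R : R[i]^o).
Proof.
move=> j U /nbhs_singleton Uj.
have jj := @discrete_set1 (discrete_topology 'I_n) j.
by apply: (@filterS _ (nbhs j) _ _ _ _ jj) => k ->.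
Qed.

Definition ebasis (i : 'I_n) : Cont R discreteCH := mkcont (@ebasis_subproof i).
End finite_discrete.


Section gluing.
Local Open Scope quotient_scope.
Variables (n : nat) (Y : compHaus) (Y1 : set Y).

Local Notation XY := (prodCH (discreteCH n) Y).

Definition glue_rel (p q : XY) : bool :=
  `[< (p.2 = q.2 /\ Y1 p.2) \/ (p.2 = q.2 /\ p.1 = q.1) >].

Fact glue_refl : reflexive glue_rel.
Proof. by move=> p; apply/asboolP; right. Qed.

Fact glue_sym : symmetric glue_rel.
Proof.
have h p q : glue_rel p q -> glue_rel q p.
  move=> /asboolP[[e y1]|[e e']]; apply/asboolP; [left|right] => //.
  by rewrite -e.
by move=> p q; apply/idP/idP; exact: h.
Qed.

Fact glue_trans : transitive glue_rel.
Proof.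
move=> q p r /asboolP[[e y1]|[e e']] /asboolP[[f z1]|[f f']]; apply/asboolP.
- by left; rewrite e.
- by left; rewrite -f.
- by left; rewrite -f e.
- by right; rewrite e e'.
Qed.

Definition glue_equiv := EquivRel glue_rel glue_refl glue_sym glue_trans.

(* the quotient space, with the quotient topology *)
Definition glue_space : topologicalType :=
  quotient_topology {eq_quot glue_equiv}.

Definition glue_pi : XY -> glue_space := \pi_({eq_quot glue_equiv}).

Lemma glue_pi_continuous : continuous glue_pi.
Proof. exact: pi_continuous. Qed.

Lemma glue_pi_surj z : exists p, glue_pi p = z.
Proof. by exists (repr z); exact: reprK. Qed.

Lemma glue_piE p q : glue_pi p = glue_pi q <-> glue_rel p q.
Proof. exact: (rwP (eqmodP glue_equiv p q)). Qed.

Lemma glue_compact : compact [set: glue_space].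
Proof.
rewrite (_ : [set: glue_space] = glue_pi @` setT); last first.
  by apply/seteqP; split=> // z _; have [p <-] := glue_pi_surj z; exists p.
apply: continuous_compact; last exact: ch_compact.
by apply: continuous_subspaceT; exact: glue_pi_continuous.
Qed.

Hypothesis Y1_closed : closed Y1.

Lemma glue_hausdorff : hausdorff_space glue_space.
Proof.
have sep (p q : XY) (U V : set XY) : open U -> open V ->
    (forall r s, glue_rel r s -> U r -> U s) ->
    (forall r s, glue_rel r s -> V r -> V s) ->
    U `&` V = set0 -> U p -> V q -> ~ cluster (nbhs (glue_pi p)) (glue_pi q).
  move=> oU oV sU sV UV Up Vq.
  have img (W : set XY) r : open W -> (forall r s, glue_rel r s -> W r -> W s) ->
      W r -> nbhs (glue_pi r) (glue_pi @` W).
    move=> oW sW Wr; apply: open_nbhs_nbhs; split; last by exists r.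
    rewrite /open/= /quotient_open (_ : _ @^-1` _ = W)//.
    apply/seteqP; split=> [s [t Wt /glue_piE ts]|s Ws]; first exact: sW ts Wt.
    by exists s.
  move=> /(_ _ _ (img _ _ oU sU Up) (img _ _ oV sV Vq)) [z [[u Uu uz] [v Vv vz]]].
  have : (U `&` V) v.
    by split=> //; apply: sU Uu; apply/glue_piE; rewrite uz.
  by rewrite UV.
move=> z z'; have [p <-] := glue_pi_surj z; have [q <-] := glue_pi_surj z'.
move=> cl; apply/glue_piE/asboolP; apply: contrapT => npq; move: cl.
have [pq1 pq2] := (not_orP _ _).1 npq.
have snd_op (A : set Y) : open A -> open (snd @^-1` A : set XY).
  by move=> oA; apply: open_comp => // r _; exact: cvg_snd.
have fst_op (A : set (discreteCH n)) : open A -> open (fst @^-1` A : set XY).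
  by move=> oA; apply: open_comp => // r _; exact: cvg_fst.
have [pq|/eqP pq] := pselect (p.2 = q.2).
  have nY : ~ Y1 p.2 by move=> ?; apply: pq1.
  have n1 : p.1 <> q.1 by move=> ?; apply: pq2.
  have oN : open (snd @^-1` (~` Y1) : set XY) by apply: snd_op; exact: closed_openC.
  pose W (i : discreteCH n) : set XY := (fst @^-1` [set i]) `&` (snd @^-1` (~` Y1)).
  have oW i : open (W i) by apply: openI => //; apply: fst_op; exact: discrete_open.
  have sW i r s : glue_rel r s -> W i r -> W i s.
    by move=> /asboolP[[_ y1]|[e2 e1]] [/= ri rY] //; split=> /=; rewrite -?e1 -?e2.
  apply: (sep p q (W p.1) (W q.1)) => //.
  - exact: sW.
  - exact: sW.
  - by apply/seteqP; split=> // r [[/= rp _] [/= rq _]]; apply: n1; rewrite -rp -rq.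
  - by split=> //=; rewrite -pq.
have := @ch_hausdorff Y; rewrite open_hausdorff => /(_ _ _ pq).
move=> [[A B] /= [/set_mem pA /set_mem qB] [oA oB /eqP AB]].
apply: (sep p q (snd @^-1` A) (snd @^-1` B)) => //.
- exact: snd_op.
- exact: snd_op.
- by move=> r s /asboolP[[e _]|[e _]] /=; rewrite e.
- by move=> r s /asboolP[[e _]|[e _]] /=; rewrite e.
- by rewrite -preimage_setI AB preimage_set0.
Qed.

Definition glueCH : compHaus := CompHaus glue_compact glue_hausdorff.

Variable R : realType.

Lemma glue_pullback_subproof (f : contAlg R glueCH) :
  continuous (fun p : XY => contFun f (glue_pi p) : R[i]^o).
Proof.
move=> p; apply: (@continuous_comp _ _ _ glue_pi (contFun f : glueCH -> R[i]^o)).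
  exact: glue_pi_continuous.
exact: contFun_continuous.
Qed.

(* composition with the projection, which embeds the functions on the quotient
   as the functions constant on the equivalence classes, see
   glue_pullback_range *)
Definition glue_pullback (f : Cont R glueCH) : Cont R XY :=
  mkcont (@glue_pullback_subproof f).

Lemma glue_pullback_range : range glue_pullback =
  [set g : Cont R XY | forall p q, glue_rel p q -> contFun g p = contFun g q].
Proof.
apply/seteqP; split=> [_ [f _ <-] p q /glue_piE pq|g gP].
  by rewrite /glue_pullback /contFun/= /mkcts; congr (contFun f _).
have cg : continuous (contFun g \o repr : glueCH -> R[i]^o).
  apply: (@repr_comp_continuous _ {eq_quot glue_equiv} _ (contFun g : XY -> R[i]^o)).
    exact: contFun_continuous.
  by move=> p q /eqP/glue_piE pq; apply/eqP; exact: gP.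
exists (mkcont cg) => //; apply: contP => p.
by apply: gP; apply/glue_piE; exact: reprK.
Qed.

End gluing.

(* Main.v *)
Require Import Defs.
From HB Require Import structures.
From mathcomp Require Import all_boot all_order all_algebra complex.
From mathcomp Require Import all_classical all_reals topology normedtype.
From mathcomp Require Import ring.

Import Order.TTheory GRing.Theory Num.Theory.
Import numFieldNormedType.Exports.

Local Open Scope classical_set_scope.
Local Open Scope ring_scope.

(** A function d on the glued space is a family of functions d_i on Y which agree
    on Y1.  The action sends it to the sum of the (e_k ⊗ d_i) ⊠ a_ki.  The factors
    e_k ⊗ d_i are not constant on the equivalence classes, but since the entries
    of a row of the magic matrix a sum to 1 the same element is
      (1 ⊗ d_0) ⊠ 1 + sum_ki (e_k ⊗ (d_i - d_0)) ⊠ a_ki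
    for any reference index 0, and now all factors are functions on the quotient:
    the differences d_i - d_0 vanish on Y1.  This formula is an algebraic tensor;
    taken as the definition of the restricted action ([glued_coaction]), it
    reduces the proposition to finite computations.

    The computations use three facts on the functions 1 ⊗ d_0 ([flat]) and
    e_k ⊗ (d_i - d_0) ([sheet]): they recover d, they multiply in the evident way,
    and the action maps a sheet e_k ⊗ g to the sum of the (e_l ⊗ g) ⊠ a_lk.  On the
    side of the quantum group they use that distinct entries of a row or of a
    column of a are orthogonal.  It suffices that this holds in every Hilbert space
    representation ([rep_orthogonal], by Pythagoras), because the norm of a
    minimal tensor product is computed there ([mt_elem_orthogonal]).
    Orthogonality in the rows makes the formula multiplicative; orthogonality in
    the columns inverts a by its transpose, which gives the density condition.

    The homomorphisms f ⊗ g in the statement are obtained from [starHom_tensor]: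
    representations pull back along homomorphisms, hence f ⊗ g does not increase
    the spatial norm of algebraic tensors and extends to the completions. *)

(** * Norm and involution *)

Section cstar_facts.
Context {R : realType} {A : cstarType R}.
Implicit Types (x y : A).

Lemma cstar_normM x y : `|x * y| <= `|x| * `|y|.
Proof. exact: cnormM_le. Qed.

Lemma star0 : star (0 : A) = 0.
Proof. by apply: (addrI (star (0 : A))); rewrite -starD !addr0. Qed.

Lemma star_sum (I : Type) (s : seq I) (P : pred I) (F : I -> A) :
  star (\sum_(i <- s | P i) F i) = \sum_(i <- s | P i) star (F i).
Proof. exact: (big_morph _ (@starD _ A) star0). Qed.

Lemma starB x y : star (x - y) = star x - star y.
Proof. by apply: (addIr (star y)); rewrite -starD !subrK. Qed.

Lemma cstar_starM x y : star (x * y) = star y * star x.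
Proof. exact: starM. Qed.

Lemma star1 : star (1 : A) = 1.
Proof. by rewrite -[LHS]mulr1 -[X in _ * X]starK -cstar_starM mulr1 starK. Qed.

Lemma norm_star x : `|star x| = `|x|.
Proof.
have le_star y : `|y| <= `|star y|.
  have [->|y0] := eqVneq y 0; first by rewrite star0.
  have : `|y| ^+ 2 <= `|star y| * `|y| by rewrite -cstar_identity cnormM_le.
  by rewrite expr2 ler_pM2r// normr_gt0.
by apply/le_anti; rewrite le_star andbT -[X in _ <= `|X|]starK le_star.
Qed.

End cstar_facts.

(** * Extension of densely defined homomorphisms *)

Section extension.
Context {R : realType} {V W : cstarType R}.
Variable graph : V -> W -> Prop.
Hypothesis graph_dom : dense [set v | exists w, graph v w].
Hypothesis graph_norm : forall v w, graph v w -> `|w| <= `|v|.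
Hypothesis graphP : forall c v w v' w',
  graph v w -> graph v' w' -> graph (c *: v + v') (c *: w + w').
Hypothesis graph1 : graph 1 1.
Hypothesis graphM : forall v w v' w',
  graph v w -> graph v' w' -> graph (v * v') (w * w').
Hypothesis graphS : forall v w, graph v w -> graph (star v) (star w).

(* the closure of the graph; each v turns out to have exactly one partner *)
Let clos v w := forall e : R[i], 0 < e ->
  exists v' w', [/\ graph v' w', `|v - v'| < e & `|w - w'| < e].

Let graph_dist v w v' w' : graph v w -> graph v' w' -> `|w - w'| <= `|v - v'|.
Proof.
move=> g g'; apply: graph_norm.
by have := graphP (-1) _ _ _ _ g' g; rewrite !scaleN1r ![- _ + _]addrC.
Qed.

Let clos_dist {v w v' w'} : clos v w -> clos v' w' -> `|w - w'| <= `|v - v'|.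
Proof.
move=> c c'.
have [//|] := @real_leP R[i] _ _ (normr_real (w - w')) (normr_real (v - v')).
rewrite -subr_gt0; set e := (X in 0 < X) => e0.
have e4 : 0 < e / 4 by rewrite divr_gt0.
have [s [t [st vs wt]]] := c _ e4; have [s' [t' [st' vs' wt']]] := c' _ e4.
have : `|w - w'| < `|v - v'| + e.
  have hs : `|s - s'| <= e / 4 + (`|v - v'| + e / 4).
    rewrite (le_trans (ler_distD v _ _))// lerD//; first by rewrite distrC ltW.
    by rewrite (le_trans (ler_distD v' _ _))// lerD2l ltW.
  have -> : `|v - v'| + e = e / 4 + (e / 4 + (`|v - v'| + e / 4) + e / 4).
    by field.
  rewrite (le_lt_trans (ler_distD t _ _))// ltr_leD//.
  rewrite (le_trans (ler_distD t' _ _))// lerD//; last by rewrite distrC ltW.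
  exact: le_trans (graph_dist _ _ _ _ st st') hs.
by rewrite /e subrKC ltxx.
Qed.

Let clos_uniq {v w w'} : clos v w -> clos v w' -> w = w'.
Proof.
move=> c c'; apply/eqP; rewrite -subr_eq0 -normr_le0.
by rewrite (le_trans (clos_dist c c'))// subrr normr0.
Qed.

Let clos_ex v : exists w, clos v w.
Proof.
have near_graph (e : R[i]) : 0 < e ->
    exists v' w', graph v' w' /\ `|v - v'| < e.
  move=> e0; have := graph_dom (ball v e).
  case=> [||v' [/= vv' [w' g]]]; first by exists v; exact: ballxx.
    exact: ball_open.
  by exists v', w'; split => //; move: vv'; rewrite -ball_normE.
(* the images of the elements of the domain close to v form a Cauchy filter,
   whose limit is the value at v *)
pose F : set_system W := [set U | exists2 e : R[i], 0 < e &
  forall v' w', graph v' w' -> `|v - v'| < e -> U w'].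
have FF : ProperFilter F.
  split.
    by move=> [e e0 h]; have [v' [w' [/h g /g]]] := near_graph e e0.
  split.
  - by exists 1.
  - move=> P Q [e e0 hP] [d d0 hQ].
    have := @real_ltP R[i] _ _ (gtr0_real e0) (gtr0_real d0).
    case=> ed.
    + exists e => // v' w' g h; split; first exact: hP g h.
      by apply: hQ g (lt_trans h ed).
    + exists d => // v' w' g h; split; last exact: hQ g h.
      by apply: hP g (lt_le_trans h ed).
  - by move=> P Q PQ [e e0 hP]; exists e => // v' w' g h; apply/PQ/(hP v').
have cF : cauchy F.
  apply/cauchyP => e e0; have e2 : 0 < e / 2 by rewrite divr_gt0.
  have [v' [w' [g h]]] := near_graph _ e2.
  exists w', (e / 2) => // s t st vs; rewrite -ball_normE/=.
  rewrite (le_lt_trans (graph_dist _ _ _ _ g st))//.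
  by rewrite -(subrKA v) (splitr e) (le_lt_trans (ler_normD _ _))// ltrD// distrC.
have /cvg_ex[w Fw] := @cauchy_cvg W F FF cF.
exists w => e e0; have [d d0] := Fw (ball w e) (nbhsx_ballx w e e0).
rewrite -ball_normE => hd.
have := @real_ltP R[i] _ _ (gtr0_real e0) (gtr0_real d0).
case=> ed.
- have [s [t [st vs]]] := near_graph e e0.
  by exists s, t; split => //; apply: (hd s t st (lt_trans vs ed)).
- have [s [t [st vs]]] := near_graph d d0.
  by exists s, t; split => //; [exact: lt_le_trans vs ed|exact: (hd s t st vs)].
Qed.

Let ext v : W := projT1 (cid (clos_ex v)).

Let extP v : clos v (ext v).
Proof. exact: projT2 (cid (clos_ex v)). Qed.

Let clos_graph {v w} : graph v w -> clos v w.
Proof. by move=> g e e0; exists v, w; rewrite !subrr !normr0. Qed.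

Let ext_linear : linear ext.
Proof.
move=> c v v'; apply: clos_uniq (extP _) _ => e e0.
have e2 : 0 < e / 2 by rewrite divr_gt0.
have d2 : 0 < e / 2 / (`|c| + 1) by rewrite divr_gt0// ltr_wpDl.
have [s [t [st vs wt]]] := extP v _ d2.
have [s' [t' [st' vs' wt']]] := extP v' _ e2.
have est (X : cstarType R) (x y x' y' : X) : `|x - y| < e / 2 / (`|c| + 1) ->
    `|x' - y'| < e / 2 -> `|c *: x + x' - (c *: y + y')| < e.
  move=> xy xy'; rewrite opprD addrACA -scalerBr (le_lt_trans (ler_normD _ _))//.
  rewrite [ltRHS]splitr normrZ ler_ltD//.
  rewrite mulrC; apply: (@le_trans _ _ (`|x - y| * (`|c| + 1))).
    by rewrite ler_wpM2l// lerDl.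
  by rewrite -ler_pdivlMr ?ltr_wpDl// ltW.
by exists (c *: s + s'), (c *: t + t'); split; [exact: graphP|exact: est..].
Qed.

Let ext1 : ext 1 = 1.
Proof. exact: clos_uniq (extP 1) (clos_graph graph1). Qed.

Let extM : {morph ext : x y / x * y}.
Proof.
move=> v v'; apply: clos_uniq (extP _) _ => e e0.
set w := ext v; set w' := ext v'.
(* From vv' - ss' = (v - s)v' + s(v' - s'): the first approximation depends on
   the size of v' and w' only, and the second may then depend on s and t. *)
have e2 : 0 < e / 2 by rewrite divr_gt0.
have d0 : 0 < e / 2 / (`|v'| + `|w'| + 1).
  by rewrite divr_gt0// ltr_wpDl// addr_ge0.
have [s [t [st vs wt]]] := extP v _ d0.
have d0' : 0 < e / 2 / (`|s| + `|t| + 1).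
  by rewrite divr_gt0// ltr_wpDl// addr_ge0.
have [s' [t' [st' vs' wt']]] := extP v' _ d0'.
have small (x y m : R[i]) :
    0 <= x -> x < e / 2 / m -> 0 < m -> y <= m -> x * y <= e / 2.
  move=> x0 xm m0 ym; apply: (@le_trans _ _ (x * m)); first by rewrite ler_wpM2l.
  by rewrite -ler_pdivlMr// ltW.
have est (X : cstarType R) (x y x' y' : X) (m m' : R[i]) :
    `|x - y| < e / 2 / m -> 0 < m -> `|x'| <= m ->
    `|x' - y'| < e / 2 / m' -> 0 < m' -> `|y| + 1 <= m' ->
    `|x * x' - y * y'| < e.
  move=> xy m0 xm xy' m0' ym'.
  have -> : x * x' - y * y' = (x - y) * x' + y * (x' - y').
    by rewrite mulrBl mulrBr addrA subrK.
  rewrite (le_lt_trans (ler_normD _ _))// (splitr e) ler_ltD//.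
    by rewrite (le_trans (cstar_normM _ _))//; apply: (small _ _ m).
  rewrite (le_lt_trans (cstar_normM _ _))// mulrC.
  apply: (@le_lt_trans _ _ (`|x' - y'| * m')); last by rewrite -ltr_pdivlMr.
  by rewrite ler_wpM2l// (le_trans _ ym')// lerDl.
exists (s * s'), (t * t'); split; first exact: graphM.
  apply: (est _ _ _ _ _ _ _ vs _ _ vs'); rewrite ?ltr_wpDl ?addr_ge0//.
    by rewrite -addrA lerDl addr_ge0.
  by rewrite lerD2r lerDl.
apply: (est _ _ _ _ _ _ _ wt _ _ wt'); rewrite ?ltr_wpDl ?addr_ge0//.
  by rewrite addrAC lerDr addr_ge0.
by rewrite lerD2r lerDr.
Qed.

Let extS : {morph ext : x / star x}.
Proof.
move=> v; apply: clos_uniq (extP _) _ => e e0.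
have [s [t [st vs wt]]] := extP v _ e0.
exists (star s), (star t).
by split; [exact: graphS|rewrite -starB norm_star..].
Qed.

(** A densely defined *-homomorphism is used through its graph: that the graph is
    a function is part of the contraction hypothesis.  The closure of the graph
    is again the graph of a contraction, defined everywhere by completeness, and
    the algebraic operations pass to the limit. *)
Lemma starHom_extension :
  exists F : starHom V W, forall v w, graph v w -> F v = w.
Proof.
pose L : {linear V -> W} := HB.pack ext
  (GRing.isLinear.Build _ _ _ _ ext ext_linear).
exists (@StarHom _ _ _ L ext1 extM extS) => v w g.
exact: clos_uniq (extP v) (clos_graph g).
Qed.

End extension.

(** * Elementary tensors *)

Section span.
Context {K : pzRingType} {V : lmodType K} (S : set V).

Lemma lspan_gen v : S v -> lspan S v.
Proof.
move=> Sv; exists [:: (1, v)]; last by rewrite big_seq1 scale1r.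
by move=> p; rewrite inE => /eqP ->.
Qed.

Lemma lspanZD (c : K) v w : lspan S v -> lspan S w -> lspan S (c *: v + w).
Proof.
move=> [r rS ->] [s sS ->]; exists ([seq (c * p.1, p.2) | p <- r] ++ s).
  by move=> p; rewrite mem_cat => /orP[/mapP[q qr ->]|]; [exact: (rS q)|exact: sS].
rewrite big_cat big_map scaler_sumr; congr (_ + _).
by apply: eq_bigr => p _; rewrite scalerA.
Qed.

Lemma lspan0 : lspan S 0.
Proof. by exists [::]; rewrite ?big_nil. Qed.

Lemma lspan_sum (I : Type) (s : seq I) (P : pred I) (F : I -> V) :
  (forall i, P i -> lspan S (F i)) -> lspan S (\sum_(i <- s | P i) F i).
Proof.
move=> FS; elim/big_ind : _ => //; first exact: lspan0.
by move=> v w Sv Sw; rewrite -[v]scale1r; exact: lspanZD.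
Qed.

End span.

Lemma dot0l (R : realType) (H : hilbertType R) (x : H) : dot (0 : H) x = 0.
Proof. by rewrite -(scale0r (0 : H)) dotZl mul0r. Qed.

Section elementary_tensors.
Context {R : realType} {A B : cstarType R} (T : minTensor A B).
Implicit Types (a : A) (b : B) (c : R[i]).

Local Notation "a ⊠ b" := (mt_elem T a b) (at level 35, right associativity).

Lemma mt_elemDl a a' b : (a + a') ⊠ b = a ⊠ b + a' ⊠ b.
Proof. by have := mt_linearl T b 1 a a'; rewrite /= !scale1r. Qed.

Lemma mt_elemDr a b b' : a ⊠ (b + b') = a ⊠ b + a ⊠ b'.
Proof. by have := mt_linearr T a 1 b b'; rewrite /= !scale1r. Qed.

Lemma mt_elem0l b : 0 ⊠ b = 0.
Proof. by apply: (addrI (0 ⊠ b)); rewrite -mt_elemDl !addr0. Qed.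

Lemma mt_elem0r a : a ⊠ 0 = 0.
Proof. by apply: (addrI (a ⊠ 0)); rewrite -mt_elemDr !addr0. Qed.

Lemma mt_elemZl c a b : (c *: a) ⊠ b = c *: (a ⊠ b).
Proof. by have := mt_linearl T b c a 0; rewrite /= mt_elem0l !addr0. Qed.

Lemma mt_elemZr c a b : a ⊠ (c *: b) = c *: (a ⊠ b).
Proof. by have := mt_linearr T a c b 0; rewrite /= mt_elem0r !addr0. Qed.

Lemma mt_elem_suml (I : Type) (s : seq I) (P : pred I) (F : I -> A) b :
  (\sum_(i <- s | P i) F i) ⊠ b = \sum_(i <- s | P i) F i ⊠ b.
Proof.
apply: (big_morph (fun x => x ⊠ b)); last exact: mt_elem0l.
by move=> x y; exact: mt_elemDl.
Qed.

Lemma mt_elem_sumr (I : Type) (s : seq I) (P : pred I) (F : I -> B) a :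
  a ⊠ (\sum_(i <- s | P i) F i) = \sum_(i <- s | P i) a ⊠ F i.
Proof.
apply: (big_morph (mt_elem T a)); last exact: mt_elem0r.
by move=> x y; exact: mt_elemDr.
Qed.

(** The spatial norm sees b only through its representations, so relations which
    hold in all Hilbert space representations can be used inside tensors. *)
Lemma mt_elem_eq0 a b :
  (forall (K : hilbertType R) (rho : starRep B K) v, rho b v = 0) ->
  a ⊠ b = 0.
Proof.
move=> rho0; apply/eqP; rewrite -normr_le0.
have := mt_norm T [:: (a, b)] (lexx 0); rewrite big_seq1 => -[_]; apply.
move=> H K pi rho t; rewrite /tnorm2 expr0n mul0r /tapply /= cats0 big_map.
rewrite big1// => u _; rewrite big_map big1// => v _.
by rewrite /= rho0 dot0l mulr0.
Qed.

Lemma dense_lspan_tensor (S : set T) :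
  (forall a b, lspan S (a ⊠ b)) -> dense (lspan S).
Proof.
move=> elemS O O0 oO; have [v [Ov [s sS vE]]] := mt_dense (m:=T) O0 oO.
exists v; split => //; rewrite vE big_seq.
apply: lspan_sum => p /sS[a _ [b _ <-]].
by rewrite -[X in lspan S X]addr0; apply: lspanZD; [exact: elemS|exact: lspan0].
Qed.

End elementary_tensors.

(** * Tensor products of homomorphisms *)

Section restriction.
Context {R : realType} {A B : cstarType R} (f : starHom A B).
Variables (H : hilbertType R) (pi : starRep B H).

Let rest a := pi (f a).

Let rest_linear a : linear (rest a).
Proof. exact: rep_linear. Qed.

Let rest_bounded a : exists M : R[i], forall x, `|rest a x| <= M * `|x|.
Proof. exact: rep_bounded. Qed.

Let rest_linearl x : linear (rest^~ x).
Proof. by move=> c a b; rewrite /rest linearP; exact: rep_linearl. Qed.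

Let rest1 x : rest 1 x = x.
Proof. by rewrite /rest hom1 rep1. Qed.

Let restM a b x : rest (a * b) x = rest a (rest b x).
Proof. by rewrite /rest homM repM. Qed.

Let restS a x y : dot (rest a x) y = dot x (rest (star a) y).
Proof. by rewrite /rest repS homS. Qed.

Definition starRep_comp : starRep A H :=
  StarRep rest_linear rest_bounded rest_linearl rest1 restM restS.

End restriction.

Definition starHom_id {R : realType} (A : cstarType R) : starHom A A :=
  @StarHom R A A idfun erefl (fun _ _ => erefl) (fun _ => erefl).

Section tensor_hom.
Context {R : realType} {A A' B B' : cstarType R}.
Variables (T : minTensor A B) (T' : minTensor A' B').
Variables (f : starHom A A') (g : starHom B B').

(** Representations of A' and B' restrict to A and B along f and g, so that the
    spatial norm on the source is a supremum over more representations. *)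
Lemma spatial_le_hom (s : seq (A * B)) (r : R[i]) :
  spatial_le s r -> spatial_le [seq (f p.1, g p.2) | p <- s] r.
Proof.
move=> sr H K pi rho t.
have := sr H K (starRep_comp f _ pi) (starRep_comp g _ rho) t.
by rewrite /tapply allpairs_mapl.
Qed.

Lemma starHom_tensor :
  exists F : starHom T T',
    forall a b, F (mt_elem T a b) = mt_elem T' (f a) (g b).
Proof.
pose img (s : seq (A * B)) := \sum_(p <- s) mt_elem T p.1 p.2.
pose img' (s : seq (A * B)) := \sum_(p <- s) mt_elem T' (f p.1) (g p.2).
pose graph v w := exists2 s, v = img s & w = img' s.
have lspan_img v : lspan [set mt_elem T a b | a in [set: A] & b in [set: B]] v ->
    exists s, v = img s.
  move=> [s + ->] {v}; elim: s => [|[c v] s ih] sS.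
    by exists [::]; rewrite /img !big_nil.
  have [q qs|r re] := ih; first by apply: sS; rewrite inE qs orbT.
  have [a _ [b _ ab]] := sS _ (mem_head _ _).
  by exists ((c *: a, b) :: r); rewrite big_cons re /img big_cons/= mt_elemZl ab.
have [||||||F FE] := @starHom_extension R T T' graph.
- move=> O O0 oO; have [v [Ov /lspan_img[s ve]]] := mt_dense (m:=T) O0 oO.
  by exists v; split => //; exists (img' s), s.
- move=> _ _ [s -> ->].
  have /(mt_norm T s (normr_ge0 _))/spatial_le_hom := lexx `|img s|.
  by move/(mt_norm T' _ (normr_ge0 _)); rewrite big_map.
- move=> c _ _ _ _ [s -> ->] [s' -> ->].
  exists ([seq (c *: p.1, p.2) | p <- s] ++ s').
    rewrite /img big_cat big_map scaler_sumr; congr (_ + _).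
    by apply: eq_bigr => p _; rewrite mt_elemZl.
  rewrite /img' big_cat big_map scaler_sumr; congr (_ + _).
  by apply: eq_bigr => p _; rewrite linearZ/= mt_elemZl.
- by exists [:: (1, 1)]; rewrite /img /img' big_seq1 ?hom1 mt1.
- move=> _ _ _ _ [s -> ->] [s' -> ->].
  exists [seq (p.1 * q.1, p.2 * q.2) | p <- s, q <- s'].
    rewrite /img big_allpairs_dep/= mulr_suml; apply: eq_bigr => p _.
    by rewrite mulr_sumr; apply: eq_bigr => q _; rewrite mtM.
  rewrite /img' big_allpairs_dep/= mulr_suml; apply: eq_bigr => p _.
  by rewrite mulr_sumr; apply: eq_bigr => q _; rewrite !homM mtM.
- move=> _ _ [s -> ->]; exists [seq (star p.1, star p.2) | p <- s].
    by rewrite /img big_map star_sum; apply: eq_bigr => p _; rewrite mtS.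
  by rewrite /img' big_map star_sum; apply: eq_bigr => p _; rewrite !homS mtS.
exists F => a b; apply: FE.
by exists [:: (a, b)]; rewrite /img /img' big_seq1.
Qed.

End tensor_hom.

(** * Orthogonality of projections with sum 1 *)

Section projections.
Context {R : realType} {A : cstarType R} {n : nat} (p : 'I_n -> A).
Hypothesis p_sa : forall i, star (p i) = p i.
Hypothesis p_idem : forall i, p i * p i = p i.
Hypothesis p_sum : \sum_i p i = 1.

(** Pythagoras: a vector u in the range of the j-th projection has
    |u|^2 = sum_k |p_k u|^2, and the term k = j is already |u|^2. *)
Lemma rep_orthogonal (H : hilbertType R) (pi : starRep A H) i j (v : H) :
  i != j -> pi (p i * p j) v = 0.
Proof.
move=> ij; rewrite repM; set u := pi (p j) v.
have uj : pi (p j) u = u by rewrite /u -repM p_idem.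
have sqE k : dot (pi (p k) u) u = `|pi (p k) u| ^+ 2.
  by rewrite -dot_norm -{1}p_idem repM repS p_sa.
have dotD_l : {morph (fun x : H => dot x u) : x y / x + y}.
  by move=> x y; exact: dotDl.
have repD : {morph (fun a : A => pi a u) : x y / x + y}.
  by move=> x y; have := rep_linearl pi u 1 x y; rewrite /= !scale1r.
have rep0 : pi 0 u = 0 by apply: (addrI (pi 0 u)); rewrite -repD !addr0.
have : `|u| ^+ 2 = \sum_k `|pi (p k) u| ^+ 2.
  rewrite -dot_norm -{1}(rep1 pi u) -p_sum (big_morph _ repD rep0).
  by rewrite (big_morph _ dotD_l (dot0l _ _ u)); apply: eq_bigr => k _.
rewrite (bigD1 j)//= uj -[LHS]addr0 => /addrI/esym/eqP.
rewrite psumr_eq0; last by move=> k _; rewrite exprn_ge0.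
by move=> /allP/(_ i (mem_index_enum i)); rewrite ij /= sqrf_eq0 normr_eq0 => /eqP.
Qed.

Lemma mt_elem_orthogonal (B : cstarType R) (T : minTensor B A) b x i j :
  i != j -> mt_elem T b (p i * p j * x) = 0.
Proof.
by move=> ij; apply: mt_elem_eq0 => K rho v; rewrite repM rep_orthogonal.
Qed.

End projections.

(** * Functions on the glued space *)

Section glued_functions.
Context {R : realType} {n : nat} {Y : compHaus} {Y1 : set Y}.
Variable Y1_closed : closed Y1.

Local Notation XY := (prodCH (discreteCH n) Y).
Local Notation D := (Cont R (glueCH n Y1_closed)).
Implicit Types (d : D) (i j k l : 'I_n) (y : Y) (c : R[i]).

Definition glue_eval d i y : R[i] :=
  contFun d (glue_pi Y1 ((i : discreteCH n), y)).

Lemma glue_evalP d d' :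
  (forall i y, glue_eval d i y = glue_eval d' i y) -> d = d'.
Proof.
by move=> dd'; apply: contP => z; have [[i y] <-] := glue_pi_surj z; exact: dd'.
Qed.

Lemma glue_evalD d d' i y :
  glue_eval (d + d') i y = glue_eval d i y + glue_eval d' i y.
Proof. by []. Qed.

Lemma glue_evalZ c d i y : glue_eval (c *: d) i y = c * glue_eval d i y.
Proof. by []. Qed.

Lemma glue_evalM d d' i y :
  glue_eval (d * d') i y = glue_eval d i y * glue_eval d' i y.
Proof. by []. Qed.

Lemma glue_eval1 i y : glue_eval 1 i y = 1.
Proof. by []. Qed.

Lemma glue_eval0 i y : glue_eval 0 i y = 0.
Proof. by []. Qed.

Lemma glue_eval_star d i y : glue_eval (star d) i y = (glue_eval d i y)^*.
Proof. by []. Qed.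

Lemma glue_eval_sum (I : Type) (s : seq I) (P : pred I) (F : I -> D) i y :
  glue_eval (\sum_(j <- s | P j) F j) i y =
  \sum_(j <- s | P j) glue_eval (F j) i y.
Proof. exact: (big_morph (fun d => glue_eval d i y)). Qed.

Lemma glue_eval_Y1 d i j y : Y1 y -> glue_eval d i y = glue_eval d j y.
Proof.
by move=> y1; congr (contFun d _); apply/glue_piE/asboolP; left.
Qed.

(** When g is not constant on the equivalence classes this is the default 0. *)
Definition glue_descend (g : Cont R XY) : D :=
  xget 0 [set d | glue_pullback d = g].

Lemma glue_descendE (g : Cont R XY) i y :
  (forall y j k, Y1 y -> contFun g (j, y) = contFun g (k, y)) ->
  glue_eval (glue_descend g) i y = contFun g (i, y).
Proof.
move=> gP; have : range (@glue_pullback n Y Y1 Y1_closed R) g.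
  rewrite glue_pullback_range => -[j u] [k v] /asboolP[/= [uv y1]|/= [-> ->]//].
  by rewrite -uv; exact: gP.
move=> [d _ dg]; have dE : [set d | glue_pullback d = g] (glue_descend g).
  by apply: xgetPex; exists d.
by rewrite -[in RHS]dE.
Qed.

Lemma branch_subproof d i : continuous (fun y : Y => glue_eval d i y : R[i]^o).
Proof.
move=> y; apply: (@continuous_comp Y XY R[i]^o (fun y => (i : discreteCH n, y))
  (contFun (glue_pullback d) : XY -> R[i]^o)); last exact: contFun_continuous.
apply: (@cvg_pair _ _ _ _ (nbhs (i : discreteCH n)) (nbhs y)).
  exact: cvg_cst.
exact: cvg_id.
Qed.

Definition branch d i : Cont R Y := mkcont (branch_subproof d i).

Variable i0 : 'I_n.

(** A function d on the glued space, with branches d_i, is cut into the function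
    1 ⊗ d_i0 and the functions e_k ⊗ (d_i - d_i0).  Unlike e_k ⊗ d_i, these are
    functions on the glued space, because all branches agree on Y1. *)
Definition flat d : D := glue_descend (pure 1 (branch d i0)).

Definition sheet d k i : D :=
  glue_descend (pure (ebasis R k) (branch d i - branch d i0)).

Lemma flatE d i y : glue_eval (flat d) i y = glue_eval d i0 y.
Proof. by rewrite glue_descendE// /contFun/= /mkcts; exact: mul1r. Qed.

Lemma sheetE d k i j y : glue_eval (sheet d k i) j y =
  (j == k)%:R * (glue_eval d i y - glue_eval d i0 y).
Proof.
rewrite glue_descendE// => {}y j1 j2 y1.
have sub0 : contFun (branch d i - branch d i0) y = 0.
  change (glue_eval d i y - glue_eval d i0 y = 0).
  by rewrite (glue_eval_Y1 d i i0)// subrr.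
change (contFun (ebasis R k) j1 * contFun (branch d i - branch d i0) y =
  contFun (ebasis R k) j2 * contFun (branch d i - branch d i0) y).
by rewrite sub0 !mulr0.
Qed.

Definition glue_evalE := (glue_evalD, glue_evalZ, glue_evalM, glue_eval1,
  glue_eval0, glue_eval_star, flatE, sheetE).

Lemma flat_linear : linear flat.
Proof. by move=> c d d'; apply: glue_evalP => i y; rewrite !glue_evalE. Qed.

Lemma sheet_linear k i : linear (fun d => sheet d k i).
Proof. by move=> c d d'; apply: glue_evalP => j y; rewrite !glue_evalE; ring. Qed.

Lemma flat1 : flat 1 = 1.
Proof. by apply: glue_evalP => i y; rewrite !glue_evalE. Qed.

Lemma sheet1 k i : sheet 1 k i = 0.
Proof. by apply: glue_evalP => j y; rewrite !glue_evalE subrr mulr0. Qed.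

Lemma flatM d d' : flat (d * d') = flat d * flat d'.
Proof. by apply: glue_evalP => i y; rewrite !glue_evalE. Qed.

Lemma sheetM d d' k i : sheet (d * d') k i =
  flat d * sheet d' k i + sheet d k i * flat d' + sheet d k i * sheet d' k i.
Proof.
apply: glue_evalP => j y; rewrite !glue_evalE.
by case: (j == k); rewrite ?mulr1n ?mulr0n; ring.
Qed.

Lemma sheetM_neq d d' k l i j : k != l -> sheet d k i * sheet d' l j = 0.
Proof.
move=> kl; apply: glue_evalP => m y; rewrite !glue_evalE.
have [->|_] := eqVneq m k; last by rewrite !mul0r.
by rewrite (negPf kl) !mul0r mulr0.
Qed.

Lemma flatS d : flat (star d) = star (flat d).
Proof. by apply: glue_evalP => i y; rewrite !glue_evalE. Qed.

Lemma sheetS d k i : sheet (star d) k i = star (sheet d k i).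
Proof.
by apply: glue_evalP => j y; rewrite !glue_evalE rmorphM rmorphB/= conjC_nat.
Qed.

Lemma flat_flat d : flat (flat d) = flat d.
Proof. by apply: glue_evalP => i y; rewrite !glue_evalE. Qed.

Lemma sheet_flat d k i : sheet (flat d) k i = 0.
Proof. by apply: glue_evalP => j y; rewrite !glue_evalE subrr mulr0. Qed.

Lemma sum_delta (m : 'I_n) (u : 'I_n -> R[i]) : \sum_k (m == k)%:R * u k = u m.
Proof.
rewrite (bigD1 m)//= eqxx mul1r big1 ?addr0// => k km.
by rewrite eq_sym (negPf km) mul0r.
Qed.

Lemma flat_sheet d k i :
  flat (sheet d k i) = \sum_l (i0 == k)%:R *: sheet d l i.
Proof.
apply: glue_evalP => j y; rewrite glue_eval_sum !glue_evalE.
under eq_bigr do rewrite !glue_evalE mulrCA.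
by rewrite sum_delta.
Qed.

Lemma sheet_sheet d k i l j :
  sheet (sheet d k i) l j = ((j == k)%:R - (i0 == k)%:R) *: sheet d l i.
Proof. by apply: glue_evalP => m y; rewrite !glue_evalE; ring. Qed.

Lemma flat_sheet_sum d : d = flat d + \sum_k sheet d k k.
Proof.
apply: glue_evalP => j y; rewrite glue_evalD glue_eval_sum !glue_evalE.
by under eq_bigr do rewrite !glue_evalE; rewrite sum_delta subrKC.
Qed.

Lemma pullback_sum_branch d :
  glue_pullback d = \sum_i pure (ebasis R i) (branch d i).
Proof.
apply: contP => -[j y].
rewrite (big_morph (fun f : Cont R XY => contFun f (j, y))
  (id1 := 0) (op1 := +%R))//.
change (glue_eval d j y = \sum_i (j == i)%:R * glue_eval d i y).
by rewrite sum_delta.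
Qed.

Lemma pullback_flat d :
  glue_pullback (flat d) = \sum_k pure (ebasis R k) (branch d i0).
Proof.
rewrite pullback_sum_branch; apply: eq_bigr => k _; congr pure.
by apply: contP => y; exact: flatE.
Qed.

Lemma pullback_sheet d k i : glue_pullback (sheet d k i) =
  pure (ebasis R k) (branch d i) - pure (ebasis R k) (branch d i0).
Proof.
apply: contP => -[j y]; rewrite [LHS]sheetE mulrBr.
by [].
Qed.

Lemma pullback_linear : linear (@glue_pullback n Y Y1 Y1_closed R).
Proof. by move=> c d d'; apply: contP. Qed.

Definition pullback_lin : {linear D -> Cont R XY} :=
  HB.pack (@glue_pullback n Y Y1 Y1_closed R)
    (GRing.isLinear.Build _ _ _ _ (@glue_pullback n Y Y1 Y1_closed R)
      pullback_linear).

Lemma pullback1 : pullback_lin 1 = 1.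
Proof. by apply: contP. Qed.

Lemma pullbackM : {morph pullback_lin : x y / x * y}.
Proof. by move=> x y; apply: contP. Qed.

Lemma pullbackS : {morph pullback_lin : x / star x}.
Proof. by move=> x; apply: contP. Qed.

Definition pullback_hom : starHom D (Cont R XY) :=
  StarHom pullback1 pullbackM pullbackS.

End glued_functions.

(** * The restricted coaction *)

Section glued_coaction.
Context {R : realType} {n : nat} {Y : compHaus} {Y1 : set Y}.
Variable Y1_closed : closed Y1.

Local Notation D := (Cont R (glueCH n Y1_closed)).

Context {A : cstarType R} (T : minTensor D A) (a : 'I_n -> 'I_n -> A).
Hypothesis a_magic : magic_relations a.
Variable i0 : 'I_n.
Implicit Types (d : D) (i j k l : 'I_n) (c : R[i]).

Local Notation "x ⊠ y" := (mt_elem T x y) (at level 35, right associativity).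
Local Notation flat := (flat Y1_closed i0).
Local Notation sheet := (sheet Y1_closed i0).

(** The value sum_ki (e_k ⊗ d_i) ⊠ a_ki of the action on X_n × Y at
    d = sum_i e_i ⊗ d_i, rewritten with tensor factors which are functions on the
    glued space: d_i0 is subtracted from every branch, and each row of a sums
    to 1. *)
Definition glued_coaction d : T :=
  flat d ⊠ 1 + \sum_k \sum_i sheet d k i ⊠ a k i.

Lemma glued_coaction_linear : linear glued_coaction.
Proof.
move=> c d d'; rewrite /glued_coaction flat_linear mt_elemDl mt_elemZl.
rewrite scalerDr addrACA; congr (_ + _).
rewrite scaler_sumr -big_split; apply: eq_bigr => k _.
rewrite scaler_sumr -big_split; apply: eq_bigr => i _ /=.
by rewrite sheet_linear mt_elemDl mt_elemZl.
Qed.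

Lemma glued_coaction1 : glued_coaction 1 = 1.
Proof.
rewrite /glued_coaction flat1 mt1 big1 ?addr0// => k _.
by rewrite big1// => i _; rewrite sheet1 mt_elem0l.
Qed.

Lemma row_mul d k i j (b : A) :
  d ⊠ (a k i * a k j * b) = (i == j)%:R *: (d ⊠ (a k i * b)).
Proof.
have [a_sa a_idem _ row_sum] := a_magic.
have [<-|ij] := eqVneq i j; first by rewrite scale1r a_idem.
by rewrite scale0r (@mt_elem_orthogonal _ _ _ (a k)).
Qed.

Lemma col_mul d k l i (b : A) :
  d ⊠ (a k i * a l i * b) = (k == l)%:R *: (d ⊠ (a k i * b)).
Proof.
have [a_sa a_idem col_sum _] := a_magic.
have [<-|kl] := eqVneq k l; first by rewrite scale1r a_idem.
by rewrite scale0r (@mt_elem_orthogonal _ _ _ (a ^~ i)).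
Qed.

Lemma glued_coactionM : {morph glued_coaction : x y / x * y}.
Proof.
move=> d d'; rewrite /glued_coaction mulrDl !mulrDr -mtM mulr1 -flatM -!addrA.
congr (_ + _).
have -> : (flat d ⊠ 1) * (\sum_k \sum_i sheet d' k i ⊠ a k i) =
    \sum_k \sum_i (flat d * sheet d' k i) ⊠ a k i.
  rewrite mulr_sumr; apply: eq_bigr => k _; rewrite mulr_sumr.
  by apply: eq_bigr => i _; rewrite -mtM mul1r.
have -> : (\sum_k \sum_i sheet d k i ⊠ a k i) * (flat d' ⊠ 1) =
    \sum_k \sum_i (sheet d k i * flat d') ⊠ a k i.
  rewrite mulr_suml; apply: eq_bigr => k _; rewrite mulr_suml.
  by apply: eq_bigr => i _; rewrite -mtM mulr1.
(* distinct sheets have product 0, and so do distinct entries of a row of a,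
   inside tensors *)
have -> : (\sum_k \sum_i sheet d k i ⊠ a k i) *
    (\sum_k \sum_i sheet d' k i ⊠ a k i) =
    \sum_k \sum_i (sheet d k i * sheet d' k i) ⊠ a k i.
  rewrite mulr_suml; apply: eq_bigr => k _.
  rewrite mulr_suml; apply: eq_bigr => i _.
  rewrite mulr_sumr (bigD1 k)//= [X in _ + X]big1 ?addr0; last first.
    move=> l lk; rewrite mulr_sumr big1// => j _.
    by rewrite -mtM sheetM_neq ?mt_elem0l// eq_sym.
  rewrite mulr_sumr (bigD1 i)//= [X in _ + X]big1 ?addr0; last first.
    move=> j ji; rewrite -mtM -[a k i * a k j]mulr1 row_mul.
    by rewrite eq_sym (negPf ji) scale0r.
  by rewrite -mtM -[a k i * a k i]mulr1 row_mul eqxx scale1r mulr1.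
rewrite -!big_split; apply: eq_bigr => k _ /=.
rewrite -!big_split; apply: eq_bigr => i _ /=.
by rewrite sheetM !mt_elemDl addrA.
Qed.

Lemma glued_coactionS : {morph glued_coaction : x / star x}.
Proof.
have [a_sa _ _ _] := a_magic.
move=> d; rewrite /glued_coaction starD star_sum -mtS flatS star1.
congr (_ + _).
apply: eq_bigr => k _; rewrite star_sum; apply: eq_bigr => i _.
by rewrite -mtS a_sa sheetS.
Qed.

Definition glued_coaction_lin : {linear D -> T} := HB.pack glued_coaction
  (GRing.isLinear.Build _ _ _ _ glued_coaction glued_coaction_linear).

Definition glued_coaction_hom : starHom D T :=
  @StarHom _ _ _ glued_coaction_lin
    glued_coaction1 glued_coactionM glued_coactionS.

Lemma glued_coaction_flat d : glued_coaction (flat d) = flat d ⊠ 1.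
Proof.
rewrite /glued_coaction flat_flat big1 ?addr0// => k _.
by rewrite big1// => i _; rewrite sheet_flat mt_elem0l.
Qed.

(** A sheet is e_k ⊗ g with g vanishing on Y1, and is mapped to
    sum_l (e_l ⊗ g) ⊠ a_lk, with no trace of the index i0. *)
Lemma glued_coaction_sheet d k i :
  glued_coaction (sheet d k i) = \sum_l sheet d l i ⊠ a l k.
Proof.
have [_ _ _ row_sum] := a_magic.
rewrite /glued_coaction flat_sheet mt_elem_suml -big_split/=.
apply: eq_bigr => l _.
(* the sheet l of the flat part of e_k ⊗ g is spread over the row l of a *)
rewrite -(row_sum l) mt_elemZl -mt_elemZr scaler_sumr mt_elem_sumr -big_split/=.
rewrite (bigD1 k)//= [X in _ + X]big1 => [|j jk].
  rewrite addr0 sheet_sheet eqxx mt_elemZl mt_elemZr -scalerDl subrKC.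
  by rewrite scale1r.
rewrite sheet_sheet (negPf jk) sub0r mt_elemZl mt_elemZr -scalerDl.
by rewrite subrr scale0r.
Qed.

(** Inside tensors sum_j a_lj a_kj = delta_kl: the magic matrix is inverted by
    its transpose.  Hence an elementary tensor (e_k ⊗ g) ⊠ b is the sum over j of the
    coaction of e_j ⊗ g times 1 ⊠ (a_kj b). *)
Lemma glued_coaction_dense :
  dense (lspan [set glued_coaction d * (1 ⊠ b)
                 | d in [set: D] & b in [set: A]]).
Proof.
have [_ _ _ row_sum] := a_magic.
set S := (X in lspan X); have inS d b : lspan S (glued_coaction d * (1 ⊠ b)).
  by apply: lspan_gen; exists d => //; exists b.
apply: dense_lspan_tensor => d b.
rewrite (flat_sheet_sum Y1_closed i0 d) mt_elemDl -[X in X + _]scale1r.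
apply: lspanZD.
  by have := inS (flat d) b; rewrite glued_coaction_flat -mtM mulr1 mul1r.
rewrite mt_elem_suml; apply: lspan_sum => k _.
have -> : sheet d k k ⊠ b =
    \sum_j glued_coaction (sheet d j k) * (1 ⊠ (a k j * b)).
  under eq_bigr => j _.
    rewrite glued_coaction_sheet mulr_suml.
    under eq_bigr => l _ do rewrite -mtM mulr1 mulrA col_mul.
    rewrite (bigD1 k)//= eqxx scale1r big1 => [|l lk]; last first.
      by rewrite (negPf lk) scale0r.
    rewrite addr0; over.
  by rewrite -mt_elem_sumr -mulr_suml row_sum mul1r.
by apply: lspan_sum => j _; exact: inS.
Qed.

End glued_coaction.

Section glued_action.
Context {R : realType} (tens : forall A B : cstarType R, minTensor A B).
Context {n : nat} {Y : compHaus} {Y1 : set Y}.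
Variable Y1_closed : closed Y1.

Local Notation D := (Cont R (glueCH n Y1_closed)).

Context {G : cqg tens} (a : 'I_n -> 'I_n -> G).
Hypothesis a_magic : magic_relations a.
Hypothesis comul_a : forall i j,
  comul G (a i j) = \sum_k (mt_elem (tens _ _) (a i k) (a k j)).
Variable i0 : 'I_n.

Local Notation alphat := (glued_coaction_hom Y1_closed (tens D G) a a_magic i0).
Local Notation flat := (flat Y1_closed i0).
Local Notation sheet := (sheet Y1_closed i0).

Local Notation "x ⊠ y" := (mt_elem (tens _ _) x y)
  (at level 35, right associativity).

Lemma assoc_rel_sum (A B C : cstarType R) (s : seq (A * B * C)) :
  assoc_rel (\sum_(p <- s) (p.1.1 ⊠ p.1.2) ⊠ p.2)
            (\sum_(p <- s) p.1.1 ⊠ (p.1.2 ⊠ p.2)).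
Proof. by apply: subset_closure; exists s. Qed.

(** Both sides are rebracketings of the finite sum of flat d ⊗ 1 ⊗ 1 and of the
    sheet d l i ⊗ a_lk ⊗ a_ki. *)
Lemma glued_coaction_identity : coaction_identity (comul G) alphat.
Proof.
have [alpha_id alphaE] := starHom_tensor (tens D G) (tens (tens D G) G)
  alphat (starHom_id G).
have [id_Delta DeltaE] := starHom_tensor (tens D G) (tens D (tens G G))
  (starHom_id D) (comul G).
exists alpha_id, id_Delta; split=> // d.
pose s := (flat d, 1 : G, 1 : G) ::
  [seq (sheet d p.1.1 p.2, a p.1.1 p.1.2, a p.1.2 p.2)
    | p <- index_enum (('I_n * 'I_n * 'I_n)%type : finType)].
have dE : alphat d = flat d ⊠ 1 + \sum_k \sum_i sheet d k i ⊠ a k i by [].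
have -> : alpha_id (alphat d) = \sum_(p <- s) (p.1.1 ⊠ p.1.2) ⊠ p.2.
  rewrite dE big_cons big_map/=.
  rewrite -(pair_bigA _
    (fun p i => (sheet d p.1 i ⊠ a p.1 p.2) ⊠ a p.2 i))/=.
  rewrite -(pair_bigA _ (fun l k => \sum_i (sheet d l i ⊠ a l k) ⊠ a k i))/=.
  rewrite linearD/= alphaE/= glued_coaction_flat; congr (_ + _).
  rewrite [RHS]exchange_big linear_sum; apply: eq_bigr => k _.
  rewrite [RHS]exchange_big linear_sum; apply: eq_bigr => i _ /=.
  by rewrite alphaE/= glued_coaction_sheet// mt_elem_suml.
have -> : id_Delta (alphat d) = \sum_(p <- s) p.1.1 ⊠ (p.1.2 ⊠ p.2).
  rewrite dE big_cons big_map/=.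
  rewrite -(pair_bigA _
    (fun p i => sheet d p.1 i ⊠ (a p.1 p.2 ⊠ a p.2 i)))/=.
  rewrite -(pair_bigA _ (fun l k => \sum_i sheet d l i ⊠ (a l k ⊠ a k i)))/=.
  rewrite linearD/= DeltaE/= hom1 -mt1; congr (_ + _).
  rewrite linear_sum; apply: eq_bigr => l _.
  rewrite [RHS]exchange_big linear_sum; apply: eq_bigr => i _ /=.
  by rewrite DeltaE/= comul_a mt_elem_sumr.
exact: assoc_rel_sum.
Qed.

Lemma glued_action : is_action alphat.
Proof.
by split; [exact: glued_coaction_identity|exact: glued_coaction_dense].
Qed.

End glued_action.

Theorem proposition3p4 (R : realType)
    (tens : forall A B : cstarType R, minTensor A B)
    (n : nat) (n_gt0 : (0 < n)%N)
    (Y : compHaus) (Y1 : set Y) (Y1_closed : closed Y1)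
    (G : cqg tens) (a : 'I_n -> 'I_n -> G)
    (G_a : is_quantum_permutation_group a)
    (alpha : starHom (Cont R (prodCH (discreteCH n) Y))
                     (tens (Cont R (prodCH (discreteCH n) Y)) G))
    (alpha_action : is_action alpha)
    (alphaE : forall (i : 'I_n) (f : Cont R Y),
       alpha (pure (ebasis R i) f)
       = \sum_(k < n) mt_elem (tens _ _) (pure (ebasis R k) f) (a k i)) :
  exists (J : starHom (tens (Cont R (glueCH n Y1_closed)) G)
                      (tens (Cont R (prodCH (discreteCH n) Y)) G))
         (alphat : starHom (Cont R (glueCH n Y1_closed))
                           (tens (Cont R (glueCH n Y1_closed)) G)),
    [/\ is_tensor_hom (@glue_pullback n Y Y1 Y1_closed R) idfun J,
        forall f, J (alphat f) = alpha (glue_pullback f)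
      & is_action alphat].
Proof.
have [[a_magic _] comul_a] := G_a.
have [_ _ _ row_sum] := a_magic.
pose i0 : 'I_n := Ordinal n_gt0.
pose D := Cont R (glueCH n Y1_closed); pose XY := prodCH (discreteCH n) Y.
have [J JE] := starHom_tensor (tens D G) (tens (Cont R XY) G)
  (pullback_hom Y1_closed) (starHom_id G).
exists J, (glued_coaction_hom Y1_closed (tens D G) a a_magic i0).
split; [exact: JE| |exact: glued_action].
move=> d.
have pureE k :
    mt_elem (tens (Cont R XY) G)
      (pure (ebasis R k) (branch Y1_closed d i0)) 1 =
    \sum_i mt_elem (tens _ _)
      (pure (ebasis R k) (branch Y1_closed d i0)) (a k i).
  by rewrite -(row_sum k) mt_elem_sumr.
have -> : alpha (glue_pullback d) = \sum_k \sum_i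
    mt_elem (tens _ _) (pure (ebasis R k) (branch Y1_closed d i)) (a k i).
  rewrite (pullback_sum_branch Y1_closed d) linear_sum exchange_big/=.
  by apply: eq_bigr => i _; rewrite alphaE.
rewrite linearD/= JE/= pullback_flat mt_elem_suml linear_sum -big_split/=.
apply: eq_bigr => k _; rewrite pureE linear_sum -big_split/=.
apply: eq_bigr => i _.
by rewrite JE/= pullback_sheet -mt_elemDl subrKC.
Qed.
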